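(* Let $n\ge p\ge 1$, let $x_1,\ldots,x_n\in\mathbb{R}^p$ be fixed vectors such that $\Sigma_n=n^{-1}\sum_{i=1}^n x_ix_i^{\rm t}$ has full rank, and let $y_i=x_i^{\rm t}\beta+\varepsilon_i$ for $i=1,\ldots,n$, with $\beta\in\mathbb{R}^p$ and $\varepsilon_1,\ldots,\varepsilon_n$ i.i.d. $N(0,\sigma^2)$, $\sigma>0$. For a subset $S$ of $\{1,\ldots,p\}$ consider the Mallows variable $$M_S^0={\rm rss}(S)/\sigma^2-n+2|S|,\qquad {\rm rss}(S)=\sum_{i=1}^n(y_i-x_{i,S}^{\rm t}\hat\beta_S)^2 .$$ Its mean is ${\rm E}\,M_S^0=|S|+\gamma_S$, where $\gamma_S=n\beta_{S^c}^{\rm t}Q_S^{-1}\beta_{S^c}/\sigma^2$.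
   Context: For $u\in\mathbb{R}^p$ and $S\subseteq\{1,\ldots,p\}$, $u_S$ denotes the subvector of entries $u_j$ with $j\in S$, and $S^c$ is the complement of $S$. The matrix $\Sigma_n$ is blocked according to indices inside $S$ (block index 0) and outside $S$ (block index 1): $\Sigma_{00,S}$ is the submatrix with rows and columns in $S$, $\Sigma_{01,S}$ has rows in $S$ and columns in $S^c$, $\Sigma_{10,S}=\Sigma_{01,S}^{\rm t}$, and $\Sigma_{11,S}$ has rows and columns in $S^c$. The submodel least squares estimator is $\hat\beta_S=\Sigma_{00,S}^{-1}n^{-1}\sum_{i=1}^n x_{i,S}y_i$. The matrix $Q_S$ is defined by $Q_S^{-1}=\Sigma_{11,S}-\Sigma_{10,S}\Sigma_{00,S}^{-1}\Sigma_{01,S}$. Terms involving empty index sets are read as zero. The expectation is under the full model $y_i=x_i^{\rm t}\beta+\varepsilon_i$, so the submodel $S$ need not be correct. *)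

(* Defs.v *)
From HB Require Import structures.
From mathcomp Require Export all_boot all_order all_algebra.
From mathcomp Require Export all_classical all_reals all_analysis.
Export Order.TTheory GRing.Theory Num.Theory.
Export numFieldNormedType.Exports.

Set Implicit Arguments.
Unset Strict Implicit.
Unset Printing Implicit Defensive.

Local Open Scope classical_set_scope.
Local Open Scope ring_scope.

Section Probability.
Context d (T : measurableType d) (R : realType) (P : probability T R).

Definition mutually_independent (I : finType) (X : I -> {RV P >-> R}) : Prop :=
  forall (J : {set I}) (B : I -> set R),
    (forall i, measurable (B i)) ->
    P (\bigcap_(i in [set` J]) (X i @^-1` B i)) =
      (\prod_(i in J) P (X i @^-1` B i))%E.

(* Equality of laws is only required on Borel sets. The second parameter of
   [normal_prob] is the standard deviation, so this is N(mu, sigma^2). *)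
Definition normally_distributed (mu sigma : R) (X : {RV P >-> R}) : Prop :=
  forall B : set R, measurable B -> distribution P X B = normal_prob mu sigma B.

End Probability.

Section Submodels.
Context (R : realType) (n p : nat).

(* Increasing enumeration of S, used to index subvectors and blocks. When S is
   empty the blocks have dimension 0 and every product through them is zero. *)
Definition idx (S : {set 'I_p}) : 'I_#|S| -> 'I_p := @enum_val _ (mem S).

Definition subvec (S : {set 'I_p}) (u : 'cV[R]_p) : 'cV[R]_#|S| :=
  rowsub (@idx S) u.

Definition block (S S' : {set 'I_p}) (A : 'M[R]_p) : 'M[R]_(#|S|, #|S'|) :=
  mxsub (@idx S) (@idx S') A.

Variables (x : 'I_n -> 'cV[R]_p) (S : {set 'I_p}).

Definition Sigma : 'M[R]_p := n%:R^-1 *: \sum_(i < n) x i *m (x i)^T.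

Definition Sigma00 := block S S Sigma.
Definition Sigma01 := block S (~: S) Sigma.
Definition Sigma10 := Sigma01^T.
Definition Sigma11 := block (~: S) (~: S) Sigma.

Definition Q : 'M[R]_#|~: S| :=
  invmx (Sigma11 - Sigma10 *m invmx Sigma00 *m Sigma01).

Definition beta_hat (y : 'I_n -> R) : 'cV[R]_#|S| :=
  invmx Sigma00 *m (n%:R^-1 *: \sum_(i < n) y i *: subvec S (x i)).

Definition rss (y : 'I_n -> R) : R :=
  \sum_(i < n) (y i - ((subvec S (x i))^T *m beta_hat y) 0 0) ^+ 2.

Definition mallows (sigma : R) (y : 'I_n -> R) : R :=
  rss y / sigma ^+ 2 - n%:R + 2 * #|S|%:R.

Definition gamma (beta : 'cV[R]_p) (sigma : R) : R :=
  n%:R * ((subvec (~: S) beta)^T *m invmx Q *m subvec (~: S) beta) 0 0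
    / sigma ^+ 2.

End Submodels.

(* Main.v *)
From HB Require Import structures.
Require Import Defs.
From mathcomp Require Import measurable_realfun ring.

(** Let X0 and X1 be the design matrices of the covariates inside and outside S,
    and G = 1 - X0 (X0^T X0)^-1 X0^T the projector onto the orthogonal complement
    of the columns of X0. Then rss(S) = y^T G y and, since G X0 = 0, the covariates
    in S drop out: with b1 the subvector of beta outside S,
      rss(S) = b1^T X1^T G X1 b1 + 2 b1^T X1^T G e + e^T G e.
    The first term is n b1^T Q^-1 b1 because Q^-1 is the Schur complement
    X1^T G X1 / n, the second is centred, and the errors being uncorrelated with
    variance sigma^2, the third has mean sigma^2 tr G = sigma^2 (n - |S|). *)

Set Implicit Arguments.
Unset Strict Implicit.
Unset Printing Implicit Defensive.

Local Open Scope ring_scope.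

(** * Moments of the centred normal distribution *)

Section normal_moments.
Local Open Scope classical_set_scope.
Context {R : realType}.
Local Notation mu := (@lebesgue_measure R).

(** Lebesgue measure is invariant under reflection. This is used to match the positive and negative
    parts of a centred normal variable. *)
Lemma ge0_integralT_opp (f : R -> R) : (forall x, 0 <= f x) ->
  measurable_fun setT f ->
  (\int[mu]_x (f (- x))%:E = \int[mu]_x (f x)%:E)%E.
Proof.
move=> f0 mf.
have mN : measurable_fun setT (-%R : measurableTypeR R -> measurableTypeR R).
  exact: oppr_measurable.
rewrite -[LHS](ge0_integral_pushforward mN mu measurableT (f := EFin \o f))
  => //; last first.
  by move=> y _; rewrite lee_fin.
  exact/measurable_EFinP.
by apply: eq_measure_integral => A mA _; exact: lebesgue_measureN.
Qed.

Variable s : R.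
Hypothesis s0 : 0 < s.
Local Notation phi := (normal_pdf 0 s).

Let sn0 : s != 0. Proof. by rewrite gt_eqF. Qed.

Lemma is_derive_normal_pdf (x : R) :
  is_derive x 1 phi (- (x / s ^+ 2) * phi x).
Proof.
have phiE : phi = cst (normal_peak s) *
    (expR \o (cst (- (s ^+ 2 *+ 2)^-1) * (@idfun R) ^+ 2)).
  rewrite normal_pdfE//; apply/funext => y; rewrite /normal_fun !fctE/= subr0.
  by congr (_ * expR _); rewrite -[RHS]mulrC mulNr mulrN.
pose c := - (s ^+ 2 *+ 2)^-1.
have d1 : is_derive x 1 (cst c * (@idfun R) ^+ 2) (c * (x *+ 2)).
  apply: is_derive_eq.
  rewrite !fctE scaler0 addr0 /GRing.scale/= mulr1 expr1.
  by rewrite mulr_natl.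
have d2 := is_derive1_comp (is_derive_expR _) d1.
rewrite [X in is_derive _ _ X _]phiE; apply: is_derive_eq.
rewrite phiE !fctE scaler0 addr0 /GRing.scale/= -/c.
set e := expR _.
by rewrite /c; field.
Qed.

Lemma normal_pdf_even (x : R) : phi (- x) = phi x.
Proof. by rewrite !normal_pdfE//= /normal_fun !subr0 sqrrN. Qed.

(** With t = x^2 / (2 s^2) this reads t exp(-t) <= 1, which follows from t <= 1 + t <= exp t. *)
Lemma sqr_normal_pdf_le (x : R) : x ^+ 2 * phi x <= s ^+ 2 *+ 2 * normal_peak s.
Proof.
rewrite normal_pdfE// /normal_fun subr0 mulrCA [leRHS]mulrC.
rewrite ler_wpM2l ?normal_peak_ge0//.
have s2 : 0 < s ^+ 2 *+ 2 by rewrite mulrn_wgt0// exprn_gt0.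
rewrite mulNr expRN -ler_pdivlMr ?invr_gt0 ?expR_gt0// invrK.
rewrite -ler_pdivrMl// mulrC (le_trans _ (expR_ge1Dx _))//.
by rewrite lerDr.
Qed.

Lemma cvg_mulid_normal_pdf : x * phi x @[x --> +oo] --> (0 : R).
Proof.
pose K := s ^+ 2 *+ 2 * normal_peak s.
(* The upper bound is the one on [x ^+ 2 * phi x], divided by x. *)
apply: (@squeeze_cvgr _ _ _ _ (cst 0) (fun x => K * x^-1)).
- near=> x; have x0 : 0 < x by near: x; exact: nbhs_pinfty_gt.
  rewrite mulr_ge0 ?normal_pdf_ge0 ?(ltW x0)//=.
  by rewrite ler_pdivlMr// mulrAC -expr2 sqr_normal_pdf_le.
- exact: cvg_cst.
- rewrite -[X in _ --> X](mulr0 K); apply: cvgM; first exact: cvg_cst.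
  apply/gtr0_cvgV0; last exact: cvg_id.
  by near=> x; near: x; exact: nbhs_pinfty_gt.
Unshelve. all: by end_near. Qed.

(* The density phi satisfies s^2 phi'(x) = - x phi(x), so (x^2 - s^2) phi(x) has
   an elementary primitive vanishing at 0 and at infinity. The integral is split
   at s because the integrand changes sign there. *)
Let primitive (x : R) := - s ^+ 2 * (x * phi x).
Let excess (x : R) := (x ^+ 2 - s ^+ 2) * phi x.

Let is_derive_primitive (x : R) : is_derive x 1 primitive (excess x).
Proof.
have d1 := is_derive_normal_pdf x.
have -> : primitive = cst (- s ^+ 2) * (@idfun R * phi) by apply/funext => y.
apply: is_derive_eq.
rewrite !fctE scaler0 addr0 /GRing.scale/= /excess.
by field.
Qed.

Let cphi : continuous phi := @continuous_normal_pdf R 0 s sn0.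

Let csqr_phi : continuous (fun x : R => x ^+ 2 * phi x).
Proof. by move=> x; apply: cvgM; [exact: exprn_continuous|exact: cphi]. Qed.

Let cexcess : continuous excess.
Proof.
move=> x; apply: cvgM; last exact: cphi.
by apply: cvgB; [exact: exprn_continuous|exact: cvg_cst].
Qed.

Let cprimitive : continuous primitive.
Proof.
move=> x; apply/differentiable_continuous/derivable1_diffP.
by have [] := is_derive_primitive x.
Qed.

Let derive1_primitive : (primitive^`())%classic =1 excess.
Proof.
by move=> x; rewrite derive1E; have [_ ->] := is_derive_primitive x.
Qed.

Let integral_excess_0s :
  (\int[mu]_(x in `[0%R, s]) (excess x)%:E = (primitive s)%:E)%E.
Proof.
rewrite (@continuous_FTC2 _ excess primitive)//.
- by rewrite /primitive mul0r mulr0 sube0.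
- exact: continuous_subspaceT.
- split.
  + by move=> x _; have [] := is_derive_primitive x.
  + exact/cvg_at_right_filter/cprimitive.
  + exact/cvg_at_left_filter/cprimitive.
Qed.

Let integral_excess_sy :
  (\int[mu]_(x in `[s, +oo[) (excess x)%:E = - (primitive s)%:E)%E.
Proof.
rewrite (@ge0_continuous_FTC2y _ excess primitive _ 0)//.
- by rewrite sub0e.
- move=> x sx; rewrite mulr_ge0 ?normal_pdf_ge0// subr_ge0 lerXn2r//.
  + by rewrite nnegrE ltW.
  + by rewrite nnegrE ltW// (lt_le_trans s0).
- exact: continuous_subspaceT.
- rewrite -[X in _ --> X](mulr0 (- s ^+ 2)); apply: cvgM; first exact: cvg_cst.
  exact: cvg_mulid_normal_pdf.
- by move=> x _; have [] := is_derive_primitive x.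
- exact/cvg_at_right_filter/cprimitive.
Qed.

(** By evenness it suffices to integrate over the half-line. There x^2 phi = [excess] + s^2 phi, and
    the integrals of [excess] on the two sides of s are opposite, so only the mass of s^2 phi
    remains. *)
Lemma second_moment_normal_pdf :
  (\int[mu]_x (x ^+ 2 * phi x)%:E = (s ^+ 2)%:E)%E.
Proof.
pose g (x : R) := s ^+ 2 * phi x.
have g0 x : 0 <= g x by rewrite mulr_ge0 ?sqr_ge0// normal_pdf_ge0.
have cg : continuous g by move=> x; apply: cvgM; [exact: cvg_cst|exact: cphi].
have h0 x : 0 <= x ^+ 2 * phi x by rewrite mulr_ge0 ?sqr_ge0// normal_pdf_ge0.
have int_g : (\int[mu]_x (g x)%:E = (s ^+ 2)%:E)%E.
  under eq_integral do rewrite EFinM.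
  rewrite ge0_integralZl//.
  - by rewrite integral_normal_pdf mule1.
  - by apply/measurable_EFinP; exact: measurable_normal_pdf.
  - by move=> x _; rewrite lee_fin normal_pdf_ge0.
  - by rewrite lee_fin sqr_ge0.
rewrite -int_g !ge0_symfun_integralT//; last 2 first.
- by move=> x; rewrite /g/= normal_pdf_even.
- by move=> x; rewrite /= sqrrN normal_pdf_even.
congr *%E; rewrite -set_itvcy.
have split_s (h : R -> R) : (forall x, 0 <= h x) -> continuous h ->
    (\int[mu]_(x in `[0%R, +oo[) (h x)%:E =
     \int[mu]_(x in `[0%R, s]) (h x)%:E + \int[mu]_(x in `[s, +oo[) (h x)%:E)%E.
  move=> hge0 ch; have mh : measurable_fun [set: R] h.
    exact: continuous_measurable_fun.
  (* Both intervals contain s; dropping this null point from the second makes them disjoint. *)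
  rewrite -(@integral_itv_obnd_cbnd _ s)//; last first.
    exact/measurable_EFinP/measurable_funTS.
  rewrite (@itv_bndbnd_setU _ _ _ (BRight s)) ?bnd_simp ?ltW//.
  rewrite ge0_integral_setU//=.
  - exact/measurable_EFinP/measurable_funTS.
  - by move=> x _; rewrite lee_fin.
  - apply/disj_setPRL => x/=; rewrite !in_itv/= andbT => sx /andP[_].
    by rewrite leNgt sx.
rewrite (split_s g)// (split_s (fun x => x ^+ 2 * phi x))//.
have hE x : (x ^+ 2 * phi x)%:E = ((excess x)%:E + (g x)%:E)%E.
  by rewrite -EFinD /excess /g -mulrDl subrK.
have int0s : (\int[mu]_(x in `[0%R, s]) (x ^+ 2 * phi x)%:E =
    (primitive s)%:E + \int[mu]_(x in `[0%R, s]) (g x)%:E)%E.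
  under eq_integral do rewrite hE.
  (* [excess] is nonpositive on this interval, so additivity rests on integrability of continuous
     functions on a compact set; beyond s nonnegativity is enough. *)
  rewrite integralD//= ?integral_excess_0s//;
    by apply: continuous_compact_integrable;
      [exact: segment_compact|exact: continuous_subspaceT].
have intsy : (\int[mu]_(x in `[s, +oo[) (x ^+ 2 * phi x)%:E =
    - (primitive s)%:E + \int[mu]_(x in `[s, +oo[) (g x)%:E)%E.
  under eq_integral do rewrite hE.
  rewrite ge0_integralD//= ?integral_excess_sy//.
  - move=> x; rewrite in_itv/= andbT => sx.
    rewrite lee_fin mulr_ge0 ?normal_pdf_ge0// subr_ge0 lerXn2r//.
    + by rewrite nnegrE ltW.
    + by rewrite nnegrE ltW// (lt_le_trans s0).
  - apply/measurable_EFinP; apply: measurable_funTS.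
    exact: continuous_measurable_fun.
  - by move=> x _; rewrite lee_fin.
  - apply/measurable_EFinP; apply: measurable_funTS.
    exact: continuous_measurable_fun.
by rewrite int0s intsy addeACA -EFinN -EFinD subrr add0e.
Qed.

(** The change of variables is available for the Radon-Nikodym derivative, which equals [phi] almost
    everywhere because both have the same integral over every measurable set. *)
Lemma ge0_integral_normal_prob (h : R -> R) : (forall x, 0 <= h x) ->
  measurable_fun setT h ->
  (\int[normal_prob 0%R s]_x (h x)%:E = \int[mu]_x (h x * phi x)%:E)%E.
Proof.
move=> h0 mh.
have dom := normal_prob_dominates (0:R) s.
rewrite -(Radon_Nikodym_SigmaFinite.change_of_variables dom)//; last first.
  exact/measurable_EFinP.
have mg := measurable_int _ (Radon_Nikodym_SigmaFinite.f_integrable dom).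
under [RHS]eq_integral do rewrite EFinM.
apply: ae_eq_integral => //.
- by apply: emeasurable_funM => //; exact/measurable_EFinP.
- apply: emeasurable_funM; apply/measurable_EFinP => //.
  exact: measurable_normal_pdf.
- apply: ae_eqe_mul2l.
  apply: integral_ae_eq => //.
  + exact: Radon_Nikodym_SigmaFinite.f_integrable.
  + by apply/measurable_EFinP; exact: measurable_normal_pdf.
  + by move=> E _ mE; rewrite -Radon_Nikodym_SigmaFinite.f_integral.
Qed.

Context d (T : measurableType d) (P : probability T R) (X : {RV P >-> R}).
Hypothesis normX : normally_distributed 0 s X.

(** Restricting to nonnegative [h] avoids presupposing integrability, which is itself deduced from
    this formula. *)
Lemma ge0_expectation_normal (h : R -> R) : (forall x, 0 <= h x) ->
  measurable_fun setT h ->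
  (\int[P]_w (h (X w))%:E = \int[mu]_x (h x * phi x)%:E)%E.
Proof.
move=> h0 mh; rewrite -ge0_integral_normal_prob//.
(* R and measurableTypeR R carry convertible sigma-algebras under distinct
   displays; normal_prob lives on the latter. *)
have mX : measurable_fun setT (X : T -> measurableTypeR R).
  exact: (measurable_funPT X).
rewrite -[LHS](ge0_integral_pushforward mX P measurableT (f := EFin \o h))
  => //; last first.
  by move=> y _; rewrite lee_fin.
  exact/measurable_EFinP.
by apply: eq_measure_integral => B mB _; exact: normX.
Qed.

Lemma expectation_sqr_normal : ('E_P[fun w => (X w ^+ 2)%R] = (s ^+ 2)%:E)%E.
Proof.
rewrite unlock (ge0_expectation_normal (h := fun x => x ^+ 2)).
- exact: second_moment_normal_pdf.
- by move=> x; rewrite sqr_ge0.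
- exact: exprn_measurable.
Qed.

Lemma Lfun2_normal : (X : T -> R) \in Lfun P 2%:E.
Proof.
apply/andP; split; rewrite inE//= /finite_norm unlock/=.
apply: poweR_lty.
under eq_integral do rewrite powR_mulrn// real_normK ?num_real//.
by have := expectation_sqr_normal; rewrite unlock => ->; rewrite ltry.
Qed.

(** The transfer formula covers nonnegative functions only, so the positive and negative parts of
    [X] are treated separately; evenness of [phi] makes their integrals equal. *)
Lemma expectation_normal : ('E_P[X] = 0)%E.
Proof.
have iX : P.-integrable setT (EFin \o X).
  apply/Lfun1_integrable; apply: Lfun_subset12; last exact: Lfun2_normal.
  by rewrite fin_num_measure.
rewrite unlock integralE.
have -> : (\int[P]_w (fun w => (X w)%:E)^\- w =
           \int[P]_w (fun w => (X w)%:E)^\+ w)%E.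
  transitivity (\int[P]_w (Num.max (- X w) 0)%:E)%E.
    by apply: eq_integral => w _; rewrite funenegE -EFinN -EFin_max.
  transitivity (\int[P]_w (Num.max (X w) 0)%:E)%E; last first.
    by apply: eq_integral => w _; rewrite funeposE -EFin_max.
  have max_ge0 (y : R) : 0 <= Num.max y 0 by rewrite le_max lexx orbT.
  rewrite (ge0_expectation_normal (h := fun x => Num.max x 0))//; last first.
    exact: measurable_maxr.
  rewrite (ge0_expectation_normal (h := fun x => Num.max (- x) 0))//;
    last first.
    by apply: measurable_maxr => //; exact: oppr_measurable.
  rewrite -(ge0_integralT_opp (f := fun x => Num.max x 0 * phi x)).
  - by apply: eq_integral => x _; rewrite [in RHS]normal_pdf_even.
  - by move=> x; rewrite mulr_ge0 ?normal_pdf_ge0.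
  - apply: measurable_funM; first exact: measurable_maxr.
    exact: measurable_normal_pdf.
(* Equal extended reals cancel only when finite, hence the appeal to integrability. *)
by apply: subee; exact: integrable_pos_fin_num.
Qed.

End normal_moments.

(** * Second moments of independent errors *)

Section independence.
Local Open Scope classical_set_scope.
Context d (T : measurableType d) (R : realType) (P : probability T R).

(** Independence says that the joint law agrees with the product of the marginal laws on rectangles,
    hence everywhere; Fubini then separates the two factors. *)
Lemma expectationM_independent (X Y : {RV P >-> R}) :
  (forall A B : set R, measurable A -> measurable B ->
    P (X @^-1` A `&` Y @^-1` B) = P (X @^-1` A) * P (Y @^-1` B))%E ->
  (X : T -> R) \in Lfun P 2%:E -> (Y : T -> R) \in Lfun P 2%:E ->
  ('E_P[fun w => (X w * Y w)%R] = 'E_P[X] * 'E_P[Y])%E.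
Proof.
move=> indep X2 Y2.
have PT : P setT \is a fin_num by rewrite fin_num_measure.
have iX : P.-integrable setT (EFin \o X).
  exact/Lfun1_integrable/Lfun_subset12.
have iY : P.-integrable setT (EFin \o Y).
  exact/Lfun1_integrable/Lfun_subset12.
have iXY : P.-integrable setT (EFin \o (X \* Y)).
  exact/Lfun1_integrable/Lfun2_mul_Lfun1.
have mXY : measurable_fun setT (fun w => (X w, Y w)).
  exact: measurable_fun_pair.
pose Z : {RV P >-> (R * R)%type} :=
  HB.pack (fun w => (X w, Y w)) (isMeasurableFun.Build _ _ _ _ _ mXY).
pose mul (z : R * R) : \bar R := (z.1 * z.2)%:E.
have mmul : measurable_fun setT mul.
  by apply/measurable_EFinP; apply: measurable_funM.
pose m := (distribution P X \x distribution P Y)%E.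
have lawZ (C : set (R * R)) : measurable C -> m C = distribution P Z C.
  by apply: product_measure_unique => A B mA mB; exact: indep.
have eqZ (h : R * R -> \bar R) :
    (\int[m]_z h z = \int[distribution P Z]_z h z)%E.
  by apply: eq_measure_integral => C mC _; exact: lawZ.
(* Fubini needs integrability under the product law; it is carried over from that of [X * Y] through
   the joint law. *)
have imul : m.-integrable setT mul.
  apply/integrableP; split => //.
  rewrite eqZ.
  by have /integrableP[] := integrable_pushforward mXY mmul iXY measurableT.
rewrite unlock -[LHS](integral_distribution (X := Z) mmul iXY) -eqZ.
rewrite -integral12_prod_meas1//.
rewrite -(integral_distribution _ iX)// -(integral_distribution _ iY)//.
have mEFin := @EFin_measurable R setT.
have idX : (distribution P X).-integrable setT EFin :=
  integrable_pushforward (measurable_funPT X) mEFin iX measurableT.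
have idY : (distribution P Y).-integrable setT EFin :=
  integrable_pushforward (measurable_funPT Y) mEFin iY measurableT.
have EYfin := integrable_fin_num measurableT idY.
rewrite -(fineK EYfin) -integralZr//.
by apply: eq_integral => x _; rewrite (fineK EYfin) -integralZl.
Qed.

Lemma mutually_independent_pair (I : finType) (X : I -> {RV P >-> R}) (i j : I)
    (A B : set R) : mutually_independent X -> i != j ->
    measurable A -> measurable B ->
  (P (X i @^-1` A `&` X j @^-1` B) = P (X i @^-1` A) * P (X j @^-1` B))%E.
Proof.
move=> indep ij mA mB.
(* Mutual independence takes a family of sets over all of [I]; it is applied to the index set {i,
   j}, on which [C] takes the values [A] and [B]. *)
pose C k := if k == i then A else B.
have Ci : C i = A by rewrite /C eqxx.
have Cj : C j = B by rewrite /C eq_sym (negbTE ij).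
have mC k : measurable (C k) by rewrite /C; case: ifP.
have := indep [set i; j]%SET C mC; rewrite big_setU1/= ?inE// big_set1 Ci Cj.
move=> <-; congr (P _); apply/seteqP; split=> w /=.
  by move=> [Aw Bw] k /=; rewrite !inE => /orP[] /eqP ->; rewrite ?Ci ?Cj.
move=> Cw; split.
  by rewrite -Ci; apply: Cw; rewrite /= !inE eqxx.
by rewrite -Cj; apply: Cw; rewrite /= !inE eqxx orbT.
Qed.

(** Here [s] is the common variance. The linear part is centred and the off-diagonal products have
    mean zero, so the quadratic part contributes its diagonal only. *)
Lemma expectation_quadratic (n : nat) (s a : R) (b : 'I_n -> R)
    (g : 'M[R]_n) (X : 'I_n -> {RV P >-> R}) :
  (forall i, (X i : T -> R) \in Lfun P 2%:E) ->
  (forall i, 'E_P[X i] = 0)%E ->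
  (forall i j, 'E_P[fun w => (X i w * X j w)%R] =
    (if i == j then s else 0%R)%:E)%E ->
  ('E_P[fun w => (a + \sum_i b i * X i w
                  + \sum_i \sum_j g i j * (X i w * X j w))%R]
    = (a + s * \tr g)%:E)%E.
Proof.
move=> X2 EX EXX.
have PT : P setT \is a fin_num by rewrite fin_num_measure.
have iX i : P.-integrable setT (fun w => (X i w)%:E).
  exact/Lfun1_integrable/Lfun_subset12.
have iXX i j : P.-integrable setT (fun w => (X i w * X j w)%:E).
  exact/Lfun1_integrable/Lfun2_mul_Lfun1.
have ibX i : P.-integrable setT (fun w => (b i)%:E * (X i w)%:E)%E.
  exact: integrableZl.
have igX i j : P.-integrable setT (fun w => (g i j)%:E * (X i w * X j w)%:E)%E.
  exact: integrableZl.
have igXs i : P.-integrable setT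
    (fun w => \sum_j (g i j)%:E * (X i w * X j w)%:E)%E.
  exact: integrable_sum.
rewrite unlock in EX EXX *.
under eq_integral => w _.
  rewrite !EFinD -!sumEFin.
  under eq_bigr do rewrite EFinM.
  under [X in (_ + X)%E]eq_bigr do
    [rewrite -sumEFin; under eq_bigr do rewrite EFinM].
  over.
rewrite integralD//=; last 2 first.
- apply: integrableD => //; last exact: integrable_sum.
  exact: finite_measure_integrable_cst.
- exact: integrable_sum.
rewrite integralD//=; last 2 first.
- exact: finite_measure_integrable_cst.
- exact: integrable_sum.
rewrite integral_cst//= probability_setT mule1 !integral_sum//.
rewrite big1 ?adde0; last by move=> i _; rewrite integralZl// EX mule0.
rewrite EFinD; congr (_ + _)%E.
rewrite mulr_sumr -sumEFin; apply: eq_bigr => i _.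
rewrite integral_sum// (bigD1 i)//= big1 ?adde0.
  by rewrite integralZl// EXX eqxx -EFinM mulrC.
by move=> j ji; rewrite integralZl// EXX eq_sym (negbTE ji) mule0.
Qed.

End independence.

(** * The residual projector of a submodel *)

Section residual_projector.
Context (R : realFieldType) (n k l : nat).
Variables (X0 : 'M[R]_(n, k)) (X1 : 'M[R]_(n, l)).
Hypothesis n0 : n%:R != 0 :> R.

(** The factor 1/n is chosen so that every block of [Sigma] is a [gram] of two design matrices. *)
Definition gram (a b : nat) (A : 'M[R]_(n, a)) (B : 'M[R]_(n, b)) :=
  n%:R^-1 *: (A^T *m B).

Hypothesis G00 : gram X0 X0 \in unitmx.

Definition resid_proj : 'M[R]_n :=
  1%:M - n%:R^-1 *: (X0 *m invmx (gram X0 X0) *m X0^T).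
Local Notation G := resid_proj.

Lemma gram_tr (a b : nat) (A : 'M[R]_(n, a)) (B : 'M[R]_(n, b)) :
  (gram A B)^T = gram B A.
Proof. by rewrite /gram linearZ/= trmx_mul trmxK. Qed.

Lemma resid_proj_tr : G^T = G.
Proof.
rewrite /resid_proj linearB linearZ/= trmx1 !trmx_mul trmxK trmx_inv gram_tr.
by rewrite mulmxA.
Qed.

Lemma resid_proj_mul0 : G *m X0 = 0.
Proof.
rewrite /resid_proj mulmxBl mul1mx -scalemxAl -!mulmxA scalemxAr.
by rewrite scalemxAr -/(gram X0 X0) mulVmx// mulmx1 subrr.
Qed.

Lemma resid_proj_idem : G *m G = G.
Proof.
rewrite {2}/resid_proj mulmxBr mulmx1 -scalemxAr !mulmxA resid_proj_mul0.
by rewrite !mul0mx scaler0 subr0.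
Qed.

(** Cyclicity of the trace turns the fitted-value projector into the identity of size [k]. *)
Lemma resid_proj_trace : \tr G = n%:R - k%:R.
Proof.
rewrite /resid_proj linearB/= mxtrace1 -mulmxA scalemxAl mxtrace_mulC.
by rewrite -scalemxAr -mulmxA scalemxAr -/(gram X0 X0) mulVmx// mxtrace1.
Qed.

Lemma resid_proj_schur : X1^T *m G *m X1 =
  n%:R *: (gram X1 X1 - gram X1 X0 *m invmx (gram X0 X0) *m gram X0 X1).
Proof.
rewrite /resid_proj; set W := invmx _.
rewrite mulmxBr mulmx1 mulmxBl scalerBr /gram scalerA divff// scale1r.
congr (_ - _).
by rewrite -!scalemxAl -!scalemxAr -!scalemxAl scalerA divff// scale1r !mulmxA.
Qed.

End residual_projector.

(** * Blocks, estimator and residual sum of squares in terms of design matrices *)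

Section submodel.
Context (R : realType) (n p : nat) (x : 'I_n -> 'cV[R]_p).

Definition design (S : {set 'I_p}) : 'M[R]_(n, #|S|) :=
  \matrix_(i, j) x i (idx j) 0.

Lemma block_Sigma (S S' : {set 'I_p}) :
  block S S' (Sigma x) = gram (design S) (design S').
Proof.
apply/matrixP => i j; rewrite !mxE summxE; congr (_ * _).
by apply: eq_bigr => a _; rewrite !mxE big_ord1 !mxE.
Qed.

Lemma beta_hatE (S : {set 'I_p}) (y : 'I_n -> R) :
  beta_hat x S y = n%:R^-1 *:
    (invmx (gram (design S) (design S)) *m ((design S)^T *m \col_i y i)).
Proof.
rewrite /beta_hat /Sigma00 block_Sigma scalemxAr; congr (_ *m _).
congr (_ *: _); apply/colP => j; rewrite summxE !mxE.
by apply: eq_bigr => i _; rewrite !mxE mulrC.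
Qed.

Lemma design_split (S : {set 'I_p}) (b : 'cV[R]_p) :
  \col_i ((x i)^T *m b) 0 0 =
  design S *m subvec S b + design (~: S) *m subvec (~: S) b.
Proof.
apply/colP => i; rewrite !mxE.
rewrite (bigID (mem S))/=.
have split_sum (A : {set 'I_p}) : \sum_(j in A) (x i)^T 0 j * b j 0 =
    \sum_j design A i j * subvec A b j 0.
  rewrite big_enum_val.
  by apply: eq_bigr => j _; rewrite !mxE.
rewrite -!split_sum; congr (_ + _).
by apply: eq_bigl => j; rewrite inE.
Qed.

(** If v is in the left kernel of the Gram matrix, then the squared norm of [design S *m v^T]
    vanishes. Hence [Sigma x] kills v extended by zeros outside [S], and full rank forces v = 0. *)
Lemma gram_design_unit (S : {set 'I_p}) : n%:R != 0 :> R ->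
  \rank (Sigma x) = p -> gram (design S) (design S) \in unitmx.
Proof.
move=> n0 rk; have Su : Sigma x \in unitmx.
  by rewrite -row_free_unit /row_free rk.
rewrite -row_free_unit; apply: inj_row_free => v v0.
(* [E] extends a vector indexed by [S] by zeros; selecting the rows in [S] is a left inverse. *)
pose E : 'M[R]_(p, #|S|) := colsub (@idx p S) 1%:M.
pose X : 'M[R]_(n, p) := \matrix_(i, j) x i j 0.
have SX : Sigma x = n%:R^-1 *: (X^T *m X).
  apply/matrixP => i j; rewrite !mxE summxE; congr (_ * _).
  by apply: eq_bigr => a _; rewrite !mxE big_ord1 !mxE.
have XE : design S = X *m E.
  by rewrite /E mulmx_colsub mulmx1; apply/matrixP => i j; rewrite !mxE.
have Xv : design S *m v^T = 0.
  have : (design S *m v^T)^T *m (design S *m v^T) = 0.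
    rewrite trmx_mul trmxK mulmxA -(mulmxA v).
    have /(congr1 (fun M => n%:R *: (M *m v^T))) := v0.
    rewrite /gram -scalemxAr -scalemxAl scalerA divff// scale1r.
    by rewrite mul0mx scaler0.
  move=> /matrixP/(_ 0 0); rewrite mxE [RHS]mxE => /eqP.
  rewrite psumr_eq0 => [/allP h|i _]; last first.
    by rewrite [_^T _ _]mxE -expr2 sqr_ge0.
  apply/colP => i; rewrite [RHS]mxE; apply/eqP.
  by have := h i (mem_index_enum _); rewrite /= [_^T _ _]mxE mulf_eq0 orbb.
have Ev : E *m v^T = 0.
  rewrite -(mulKmx Su (E *m v^T)) SX -scalemxAl -mulmxA (mulmxA X) -XE Xv.
  by rewrite mulmx0 scaler0 mulmx0.
have EE : rowsub (@idx p S) E = 1%:M.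
  apply/matrixP => i j; rewrite !mxE; congr (_%:R).
  by rewrite (inj_eq enum_val_inj).
rewrite -[v]trmxK -[v^T]mul1mx -EE mul_rowsub_mx Ev.
by apply/rowP => j; rewrite !mxE.
Qed.

(** The residual vector is G Y, and G is symmetric and idempotent. *)
Lemma rssE (S : {set 'I_p}) (y : 'I_n -> R) :
  gram (design S) (design S) \in unitmx ->
  rss x S y = ((\col_i y i)^T *m resid_proj (design S) *m \col_i y i) 0 0.
Proof.
move=> Su; set Y := \col_i y i; set G := resid_proj _.
have -> : Y^T *m G *m Y = (G *m Y)^T *m (G *m Y).
  rewrite trmx_mul (resid_proj_tr _ : G^T = G) mulmxA -(mulmxA Y^T G G).
  by rewrite (resid_proj_idem Su : G *m G = G).
have fitE : design S *m beta_hat x S y = Y - G *m Y.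
  rewrite beta_hatE /G /resid_proj mulmxBl mul1mx opprB addrC subrK.
  by rewrite -scalemxAr -scalemxAl !mulmxA.
rewrite [RHS]mxE; apply: eq_bigr => i _.
rewrite [_^T _ _]mxE -expr2; congr (_ ^+ 2).
transitivity ((Y - design S *m beta_hat x S y) i 0).
  rewrite !mxE; congr (_ - _).
  by apply: eq_bigr => j _; rewrite !mxE.
by rewrite fitE opprB addrC subrK.
Qed.

Lemma rss_model (S : {set 'I_p}) (b : 'cV[R]_p) (e : 'I_n -> R) :
  n%:R != 0 :> R ->
  gram (design S) (design S) \in unitmx ->
  let G := resid_proj (design S) in
  let b1 := subvec (~: S) b in
  rss x S (fun i => ((x i)^T *m b) 0 0 + e i) =
    n%:R * (b1^T *m invmx (Q x S) *m b1) 0 0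
    + \sum_i 2 * (b1^T *m (design (~: S))^T *m G) 0 i * e i
    + \sum_i \sum_j G i j * (e i * e j).
Proof.
move=> n0 Su G b1; rewrite rssE// -/G.
have -> : \col_i (((x i)^T *m b) 0 0 + e i) =
    (\col_i ((x i)^T *m b) 0 0) + (\col_i e i) by apply/colP => i; rewrite !mxE.
rewrite (design_split S) -/b1; set X1 := design (~: S); set E := \col_i e i.
have GX0 (u : 'cV[R]_#|S|) : G *m (design S *m u) = 0.
  by rewrite mulmxA resid_proj_mul0// mul0mx.
have GT : G^T = G by exact: resid_proj_tr.
have schur : X1^T *m G *m X1 = n%:R *: invmx (Q x S).
  (* [invmxK] is unconditional, as [invmx] fixes singular matrices, so inverting [Q] gives back the
     Schur complement. *)
  rewrite resid_proj_schur// /Q invmxK.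
  by rewrite /Sigma11 /Sigma10 /Sigma01 /Sigma00 !block_Sigma gram_tr.
(* From here [G] enters only through its symmetry, [GX0] and [schur]. *)
clearbody G; set m0 := design S *m _; set z := X1 *m b1.
have GY : G *m (m0 + z + E) = G *m (z + E) by rewrite -addrA mulmxDr GX0 add0r.
have YG : (m0 + z + E)^T *m G = (z + E)^T *m G.
  by rewrite -[G in LHS]GT -[G in RHS]GT -!trmx_mul GY.
rewrite -mulmxA GY mulmxA YG [(z + E)^T]raddfD/= !(mulmxDl, mulmxDr).
(* The two cross terms are transposes of each other, hence equal as scalars: this is the factor
   2. *)
have -> : E^T *m G *m z = (z^T *m G *m E)^T.
  by rewrite [RHS]trmx_mul trmx_mul trmxK GT mulmxA.
have -> : z^T *m G *m z = n%:R *: (b1^T *m invmx (Q x S) *m b1).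
  rewrite /z trmx_mul !mulmxA -(mulmxA _ X1^T) -(mulmxA _ (X1^T *m G)).
  by rewrite schur -scalemxAr -scalemxAl.
have -> : z^T *m G = b1^T *m X1^T *m G by rewrite /z trmx_mul.
have quadE : (E^T *m G *m E) 0 0 = \sum_i \sum_j G i j * (e i * e j).
  rewrite mxE exchange_big; apply: eq_bigr => j _.
  rewrite mxE big_distrl; apply: eq_bigr => i _ /=.
  by rewrite !mxE; ring.
have linE (v : 'rV[R]_n) : \sum_i 2 * v 0 i * e i = (v *m E) 0 0 *+ 2.
  rewrite mxE -sumrMnl; apply: eq_bigr => i _.
  by rewrite mxE -mulrA mulr_natl.
rewrite linE -quadE; set L := _ *m E; set q := E^T *m G *m E.
by rewrite !mxE; ring.
Qed.

End submodel.

Theorem lemma2 (R : realType) (d : measure_display) (T : measurableType d)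
    (P : probability T R) (n p : nat) (x : 'I_n -> 'cV[R]_p)
    (beta : 'cV[R]_p) (sigma : R)
    (eps : 'I_n -> {RV P >-> R}) (y : 'I_n -> T -> R) (S : {set 'I_p})
    (p_ge1 : (1 <= p)%N) (n_gep : (p <= n)%N)
    (Sigma_full_rank : \rank (Sigma x) = p)
    (sigma_gt0 : 0 < sigma)
    (eps_indep : mutually_independent eps)
    (eps_normal : forall i, normally_distributed 0 sigma (eps i))
    (model : forall i w, y i w = ((x i)^T *m beta) 0 0 + eps i w) :
  ('E_P[fun w => mallows x S sigma (fun i => y i w)]
    = (#|S|%:R + gamma x S beta sigma)%:E)%E.
Proof.
have n0 : n%:R != 0 :> R.
  by rewrite pnatr_eq0 -lt0n (leq_trans p_ge1).
have Su := gram_design_unit S n0 Sigma_full_rank.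
pose c := sigma ^- 2.
pose G := resid_proj (design x S).
pose b1 := subvec (~: S) beta.
(* [a] collects everything free of the errors; the factor 1/sigma^2 is absorbed into [a], [b] and
   the matrix [c *: G]. *)
pose a := n%:R * (b1^T *m invmx (Q x S) *m b1) 0 0 * c - n%:R + 2 * #|S|%:R.
pose b i := c * (2 * (b1^T *m (design x (~: S))^T *m G) 0 i).
have -> : (fun w => mallows x S sigma (fun i => y i w)) =
    (fun w => a + \sum_i b i * eps i w +
              \sum_i \sum_j (c *: G) i j * (eps i w * eps j w)).
  apply/funext => w; under eq_fun do rewrite model.
  rewrite /mallows rss_model// -/G -/b1 -/c.
  under [X in _ = _ + X]eq_bigr => i _.
    under eq_bigr do rewrite mxE -mulrA.
    rewrite -mulr_sumr.
    over.
  under [X in _ = _ + X + _]eq_bigr do rewrite -mulrA.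
  by rewrite -!mulr_sumr /a; ring.
rewrite (expectation_quadratic (s := sigma ^+ 2)).
(* The quadratic part has mean n - |S|; added to the -n + 2|S| contained in [a], it leaves |S|. *)
- rewrite linearZ/= resid_proj_trace// mulrA divff ?mul1r; last first.
    by rewrite expf_neq0// gt_eqF.
  by congr EFin; rewrite /a /gamma -/b1 -/c; ring.
- by move=> i; exact: (Lfun2_normal sigma_gt0 (eps_normal i)).
- by move=> i; exact: (expectation_normal sigma_gt0 (eps_normal i)).
(* The diagonal entries are variances; off the diagonal the mean of the product factors by
   independence into zero means. *)
- move=> i j; case: eqVneq => [->|ij].
    exact: (expectation_sqr_normal sigma_gt0 (eps_normal j)).
  rewrite expectationM_independent.
  + by rewrite (expectation_normal sigma_gt0 (eps_normal i)) mul0e.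
  + by move=> A B mA mB; exact: mutually_independent_pair.
  + exact: (Lfun2_normal sigma_gt0 (eps_normal i)).
  + exact: (Lfun2_normal sigma_gt0 (eps_normal j)).
Qed.
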